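(* Let $d\ge 1$ and let $B\in\mathbb{R}^{d\times d}$. Define 1. $U := B^2$ (first matrix product), 2. $V := U(B+2U)$ (second matrix product), so that $V = B^3+2B^4$, 3. $P := \tfrac{3}{20}B + 2U + V$ and $Q := \tfrac{11}{40}B - \tfrac{1}{8}U + \tfrac{1}{4}V$ (linear combinations only), 4. $W := P\cdot Q$ (third matrix product). Then $$W + I + B + \tfrac{767}{800}\,U + \tfrac{15}{32}\,V \;=\; T_9(B) \;=\; I + B + B^2+\cdots+B^8 .$$ Thus $T_9(B)$ is computed with $3$ matrix products.
   Context: For a square matrix $B$ and an integer $m\ge 1$, $T_m(B) := I + B + \cdots + B^{m-1}$, where $I$ is the identity matrix. Cost is measured by the number of matrix-matrix products; additions and multiplications by scalars are free. *)

(* Defs.v *)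
From mathcomp Require Import all_boot all_order all_algebra.
From mathcomp Require Import reals.

Set Implicit Arguments.
Unset Strict Implicit.
Unset Printing Implicit Defensive.

Import GRing.Theory.
Local Open Scope ring_scope.

Definition T (R : realType) (d m : nat) (B : 'M[R]_d) : 'M[R]_d :=
  \sum_(i < m) B ^+ i.

(* Straight-line programs on one square matrix B.  Registers are numbered in
   order of creation: register 0 holds I, register 1 holds B, and each
   instruction appends one register.  [Lin [:: (c1, i1); ...]] appends the
   linear combination of the registers i1, ... with coefficients c1, ...;
   [Mul i j] appends the product of registers i and j.  A program mentions
   neither the matrix nor its dimension.  Only the Mul instructions are
   charged.  Reading a register that does not exist yet gives 0. *)
Inductive instr (R : Type) : Type :=
  | Lin of seq (R * nat)
  | Mul of nat & nat.

Arguments Mul {R}.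

Definition program (R : Type) : Type := seq (instr R).

Definition is_mul (R : Type) (i : instr R) : bool :=
  if i is Mul _ _ then true else false.

Definition products (R : Type) (p : program R) : nat := count (@is_mul R) p.

Definition step (R : realType) (d : nat) (regs : seq 'M[R]_d) (i : instr R) :
    seq 'M[R]_d :=
  rcons regs
    match i with
    | Lin s => \sum_(ci <- s) ci.1 *: nth 0 regs ci.2
    | Mul j k => nth 0 regs j *m nth 0 regs k
    end.

Definition registers (R : realType) (d : nat) (p : program R) (B : 'M[R]_d) :
    seq 'M[R]_d :=
  foldl (@step R d) [:: 1%:M; B] p.

Definition output (R : realType) (d : nat) (p : program R) (B : 'M[R]_d) :
    'M[R]_d :=
  last 0 (registers p B).

Definition T9_program (R : realType) : program R :=
  [:: Mul 1 1;                                              (* 2: U *)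
      Lin [:: (1, 1%N); (2, 2%N)];                          (* 3: B + 2U *)
      Mul 2 3;                                              (* 4: V *)
      Lin [:: (3 / 20, 1%N); (2, 2%N); (1, 4%N)];           (* 5: P *)
      Lin [:: (11 / 40, 1%N); (- (1 / 8), 2%N); (1 / 4, 4%N)]; (* 6: Q *)
      Mul 5 6;                                              (* 7: W *)
      Lin [:: (1, 7%N); (1, 0%N); (1, 1%N); (767 / 800, 2%N); (15 / 32, 4%N)]].

(* Main.v *)
Require Import Defs.
From mathcomp Require Import all_boot all_order all_algebra.
From mathcomp Require Import reals ring.

Set Implicit Arguments.
Unset Strict Implicit.
Unset Printing Implicit Defensive.

Import GRing.Theory.
Local Open Scope ring_scope.

(** All matrices involved are linear combinations of powers of one matrix B,
    and powers of B multiply by adding exponents; so the products V and W are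
    those of the polynomials
      V = x^2 (x + 2 x^2) = x^3 + 2 x^4,
      P = (3/20) x + 2 x^2 + x^3 + 2 x^4,
      Q = (11/40) x - (1/8) x^2 + (1/4) x^3 + (1/2) x^4.
    The coefficients of P and Q make the product P Q have coefficient 1 in each
    of the degrees 5 to 8, while its coefficients in degrees 2, 3 and 4 are
    33/800, 17/32 and 1/16.  The multiples of U and V added at the end, of
    coefficients 767/800 and 15/32, correct these three to 1: one multiple of V
    repairs two degrees because the defects 15/32 and 15/16 stand in the same
    ratio 1 : 2 as the coefficients of V.  The product V is [V_powers], the
    product W is [W_powers], and the statement about the program is the
    evaluation of its seven instructions. *)

(** This rule on monomials replaces evaluation of polynomials at B: the
    evaluation morphism is typed for dimensions of the form [d.+1], whereas
    here [d] is a variable. *)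
Lemma scaled_powers_mul (R : comNzRingType) (d : nat) (B : 'M[R]_d) (a b : R)
    (i j : nat) :
  (a *: B ^+ i) *m (b *: B ^+ j) = (a * b) *: B ^+ (i + j).
Proof. by rewrite -scalemxAl -scalemxAr scalerA mulmxE -exprD. Qed.

Lemma V_powers (R : comNzRingType) (d : nat) (B : 'M[R]_d) :
  B ^+ 2 *m (B + 2 *: B ^+ 2) = B ^+ 3 + 2 *: B ^+ 4.
Proof. by rewrite mulmxDr -scalemxAr mulmxE -exprSr -exprD. Qed.

(** With symbolic coefficients, the expansion is an identity of commutative
    rings, and the fractions of P and Q enter only when single coefficients are
    compared. *)
Lemma quartic_mul (R : comNzRingType) (d : nat) (B : 'M[R]_d)
    (a1 a2 a3 a4 b1 b2 b3 b4 : R) :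
  (a1 *: B + a2 *: B ^+ 2 + a3 *: B ^+ 3 + a4 *: B ^+ 4) *m
  (b1 *: B + b2 *: B ^+ 2 + b3 *: B ^+ 3 + b4 *: B ^+ 4) =
    (a1 * b1) *: B ^+ 2 + (a1 * b2 + a2 * b1) *: B ^+ 3
    + (a1 * b3 + a2 * b2 + a3 * b1) *: B ^+ 4
    + (a1 * b4 + a2 * b3 + a3 * b2 + a4 * b1) *: B ^+ 5
    + (a2 * b4 + a3 * b3 + a4 * b2) *: B ^+ 6
    + (a3 * b4 + a4 * b3) *: B ^+ 7 + (a4 * b4) *: B ^+ 8.
Proof.
rewrite -[in a1 *: B](expr1 B) -[in b1 *: B](expr1 B).
rewrite !(mulmxDl, mulmxDr) !scaled_powers_mul !(addSn, add0n).
(* The powers become independent unknowns: the identity is linear in them. *)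
move: (B ^+ 2) (B ^+ 3) (B ^+ 4) (B ^+ 5) (B ^+ 6) (B ^+ 7) (B ^+ 8).
move=> X2 X3 X4 X5 X6 X7 X8.
by apply/matrixP => i j; rewrite !mxE; ring.
Qed.

Lemma W_powers (R : realType) (d : nat) (B : 'M[R]_d) :
  let V := B ^+ 3 + 2 *: B ^+ 4 in
  ((3 / 20) *: B + 2 *: B ^+ 2 + V) *m
  ((11 / 40) *: B - (1 / 8) *: B ^+ 2 + (1 / 4) *: V) =
    (33 / 800) *: B ^+ 2 + (17 / 32) *: B ^+ 3 + (1 / 16) *: B ^+ 4
    + B ^+ 5 + B ^+ 6 + B ^+ 7 + B ^+ 8.
Proof.
move=> V; rewrite /V scalerDr scalerA -scaleNr !addrA.
rewrite -[X in (_ + X + _) *m _]scale1r quartic_mul.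
rewrite -[in RHS](scale1r (B ^+ 5)) -[in RHS](scale1r (B ^+ 6)).
rewrite -[in RHS](scale1r (B ^+ 7)) -[in RHS](scale1r (B ^+ 8)).
by do 6 (congr (_ + _); last by congr (_ *: _); field);
   congr (_ *: _); field.
Qed.

Lemma T9_powers (R : realType) (d : nat) (B : 'M[R]_d) :
  T 9 B = 1%:M + B + B ^+ 2 + B ^+ 3 + B ^+ 4 + B ^+ 5 + B ^+ 6
          + B ^+ 7 + B ^+ 8.
Proof. by rewrite /T !big_ord_recr big_ord0 /= add0r. Qed.

Theorem theorem3p1 (R : realType) (d : nat) (hd : (1 <= d)%N) (B : 'M[R]_d) :
  let U := B ^+ 2 in
  let V := U *m (B + 2 *: U) in
  let P := (3 / 20) *: B + 2 *: U + V in
  let Q := (11 / 40) *: B - (1 / 8) *: U + (1 / 4) *: V in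
  let W := P *m Q in
  [/\ V = B ^+ 3 + 2 *: B ^+ 4,
      W + 1%:M + B + (767 / 800) *: U + (15 / 32) *: V = T 9 B,
      T 9 B = 1%:M + B + B ^+ 2 + B ^+ 3 + B ^+ 4 + B ^+ 5 + B ^+ 6
              + B ^+ 7 + B ^+ 8
    & [/\ products (T9_program R) = 3%N,
          registers (T9_program R) B =
            [:: 1%:M; B; U; B + 2 *: U; V; P; Q; W;
                W + 1%:M + B + (767 / 800) *: U + (15 / 32) *: V]
        & output (T9_program R) B = T 9 B]].
Proof.
move=> U V P Q W.
have defV : V = B ^+ 3 + 2 *: B ^+ 4 by exact: V_powers.
have sumW : W + 1%:M + B + (767 / 800) *: U + (15 / 32) *: V = T 9 B.
  rewrite /W /P /Q defV W_powers T9_powers /U.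
  move: (B ^+ 2) (B ^+ 3) (B ^+ 4) (B ^+ 5) (B ^+ 6) (B ^+ 7) (B ^+ 8).
  move=> X2 X3 X4 X5 X6 X7 X8.
  by apply/matrixP => i j; rewrite !mxE; field.
have regs : registers (T9_program R) B =
    [:: 1%:M; B; U; B + 2 *: U; V; P; Q; W;
        W + 1%:M + B + (767 / 800) *: U + (15 / 32) *: V].
  rewrite /registers /= /step /= !big_cons !big_nil /=.
  by rewrite !scale1r !addr0 !addrA scaleNr.
split=> //; first exact: T9_powers.
by split=> //; rewrite /output regs.
Qed.
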